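(* Let $(G,p)$ be a countably infinite bar-joint framework in $\mathbb{R}^d$ with bounded bar lengths. If $(G,p)$ is boundedly prestress stable then it is directedly continuously rigid.
   Context: **Frameworks.** A countably infinite bar-joint framework $(G,p)$ in $\mathbb{R}^d$ is a countably infinite simple graph $G=(V,E)$, $V=\{1,2,\dots\}$, with a placement $p=(p_1,p_2,\dots)$, $p_i\in\mathbb{R}^d$. It has bounded bar lengths if $\sup_{ij\in E}|p_i-p_j|<\infty$. **Flexes.** An infinitesimal flex is a velocity field $u=(u_i)$, $u_i\in\mathbb{R}^d$, with $(p_i-p_j)\cdot(u_i-u_j)=0$ for all $ij\in E$. It is trivial if it is a rigid motion flex, i.e. $u_i=Ap_i+b$ for all $i$, with $A$ a skew-symmetric $d\times d$ matrix and $b\in\mathbb{R}^d$. It is bounded if it belongs to $\ell^\infty\otimes\mathbb{R}^d$, the space of sequences $u$ in $\mathbb{R}^d$ with $\|u\|=\sup_k|u_k|<\infty$, where $|\cdot|$ is the Euclidean norm. **Stresses.** A stress is a function $\omega:E\to\mathbb{R}$, with the conventions $\omega_{ij}=\omega_{ji}$ and $\omega_{ij}=0$ if $i=j$ or $ij\notin E$. It is an equilibrium stress for $(G,p)$ if $\sum_j\omega_{ij}(p_i-p_j)=0$ for every vertex $i$, and it is summable if $\sum_{i<j}|\omega_{ij}|<\infty$. **Bounded prestress stability.** A framework $(G,p)$ with bounded bar lengths is boundedly prestress stable if there is a summable equilibrium stress $\omega$ such that $\sum_{i<j}\omega_{ij}|u_i-u_j|^2>0$ for all bounded nontrivial infinitesimal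 flexes $u$ of $(G,p)$. **Directed continuous rigidity.** A continuous motion of $(G,p)$ is a family $p(t)=(p_k(t))_{k}$, $t\in[0,1]$, with each $p_k(t)\in\mathbb{R}^d$ continuous in $t$, $p(0)=p$, and $|p_i(t)-p_j(t)|=|p_i-p_j|$ for all $ij\in E$ and all $t$. A directed bounded motion is a continuous motion for which the limit $\lim_{t\to0+}(p(t)-p(0))/t=(p_k'(0))_k$ exists with respect to norm convergence in $\ell^\infty\otimes\mathbb{R}^d$; it is nontrivial if the infinitesimal flex $p'(0)$ is nontrivial. $(G,p)$ is directedly continuously rigid if it has no nontrivial directed bounded motions. *)

(* Defs.v *)
From HB Require Import structures.
From mathcomp Require Import all_boot all_order all_algebra.
From mathcomp Require Import all_classical all_reals all_analysis.
Set Implicit Arguments.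
Unset Strict Implicit.
Unset Printing Implicit Defensive.
Import Order.TTheory GRing.Theory Num.Theory.
Import numFieldNormedType.Exports.
Local Open Scope classical_set_scope.
Local Open Scope ring_scope.

(* The vertex set of a countably infinite graph is relabelled as nat. *)
Record sgraph := SGraph {
  adj : rel nat;
  adj_sym : symmetric adj;
  adj_irr : irreflexive adj }.

(* Points and velocities of R^d are column vectors.  The norm that the library
   puts on 'cV[R]_d is the maximum norm, so the Euclidean norm is defined here;
   both induce the same topology. *)
Definition dot (R : realType) (d : nat) (x y : 'cV[R]_d) : R :=
  \sum_(k < d) x k 0 * y k 0.

Definition enorm (R : realType) (d : nat) (x : 'cV[R]_d) : R :=
  Num.sqrt (dot x x).

Definition bounded_bars (R : realType) (d : nat) (G : sgraph)
    (p : nat -> 'cV[R]_d) : Prop :=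
  (ereal_sup [set (enorm (p e.1 - p e.2))%:E |
              e in [set e : nat * nat | adj G e.1 e.2]] < +oo)%E.

(* The norm of l^oo (x) R^d, with value +oo outside that space. *)
Definition linf_norm (R : realType) (d : nat) (u : nat -> 'cV[R]_d) : \bar R :=
  ereal_sup (range (fun k => (enorm (u k))%:E)).

Definition bounded_field (R : realType) (d : nat) (u : nat -> 'cV[R]_d) : Prop :=
  (linf_norm u < +oo)%E.

Definition inf_flex (R : realType) (d : nat) (G : sgraph)
    (p u : nat -> 'cV[R]_d) : Prop :=
  forall i j, adj G i j -> dot (p i - p j) (u i - u j) = 0.

Definition trivial_flex (R : realType) (d : nat) (p u : nat -> 'cV[R]_d) : Prop :=
  exists (A : 'M[R]_d) (b : 'cV[R]_d),
    A^T = - A /\ forall i, u i = A *m p i + b.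

Definition is_stress (R : realType) (G : sgraph) (w : nat -> nat -> R) : Prop :=
  (forall i j, w i j = w j i) /\ (forall i j, ~~ adj G i j -> w i j = 0).

(* The graph need not be locally finite, so the sum at a vertex is a series. *)
Definition equilibrium_stress (R : realType) (d : nat) (G : sgraph)
    (p : nat -> 'cV[R]_d) (w : nat -> nat -> R) : Prop :=
  is_stress G w /\
  forall i, series (fun j => w i j *: (p i - p j)) @ \oo --> (0 : 'cV[R]_d).

Definition lt_pairs : set (nat * nat) := [set e | (e.1 < e.2)%N].

Definition summable_stress (R : realType) (w : nat -> nat -> R) : Prop :=
  summable lt_pairs (fun e => (w e.1 e.2)%:E).

(* [esum] is only meaningful for nonnegative families: the sum over i < j of an
   absolutely summable real family is the sum of its positive parts minus the
   sum of its negative parts. *)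
Definition sum_lt (R : realType) (f : nat -> nat -> R) : \bar R :=
  (\esum_(e in lt_pairs) (Num.max (f e.1 e.2) 0)%R%:E
   - \esum_(e in lt_pairs) (Num.max (- f e.1 e.2) 0)%R%:E)%E.

Definition boundedly_prestress_stable (R : realType) (d : nat) (G : sgraph)
    (p : nat -> 'cV[R]_d) : Prop :=
  exists w : nat -> nat -> R,
    [/\ equilibrium_stress G p w, summable_stress w &
      forall u : nat -> 'cV[R]_d,
        inf_flex G p u -> bounded_field u -> ~ trivial_flex p u ->
        (0 < sum_lt (fun i j => (w i j * enorm (u i - u j) ^+ 2)%R))%E].

(* Only the values q t k with t in [0, 1] are constrained. *)
Definition continuous_motion (R : realType) (d : nat) (G : sgraph)
    (p : nat -> 'cV[R]_d) (q : R -> nat -> 'cV[R]_d) : Prop :=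
  [/\ forall k, {within `[0, 1], continuous (fun t => q t k)},
      q 0 = p &
      forall t : R, 0 <= t <= 1 ->
        forall i j, adj G i j -> enorm (q t i - q t j) = enorm (p i - p j)].

(* u is the limit of (q t - q 0) / t in l^oo (x) R^d as t tends to 0+. *)
Definition initial_velocity (R : realType) (d : nat)
    (q : R -> nat -> 'cV[R]_d) (u : nat -> 'cV[R]_d) : Prop :=
  bounded_field u /\
  linf_norm (fun k => t^-1 *: (q t k - q 0 k) - u k) @[t --> 0^'+] --> 0%E.

Definition directed_bounded_motion (R : realType) (d : nat) (G : sgraph)
    (p : nat -> 'cV[R]_d) (q : R -> nat -> 'cV[R]_d) : Prop :=
  continuous_motion G p q /\ exists u, initial_velocity q u.

Definition nontrivial_motion (R : realType) (d : nat)
    (p : nat -> 'cV[R]_d) (q : R -> nat -> 'cV[R]_d) : Prop :=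
  exists u, initial_velocity q u /\ ~ trivial_flex p u.

Definition directedly_continuously_rigid (R : realType) (d : nat) (G : sgraph)
    (p : nat -> 'cV[R]_d) : Prop :=
  ~ exists q, directed_bounded_motion G p q /\ nontrivial_motion p q.

(* Main.v *)
(* For a motion q write q(t) = p + t v(t).  Preservation of a bar gives
   2 (p_i - p_j).(v_i - v_j) = - t |v_i - v_j|^2.  Pairing the equilibrium
   equations with the bounded field v(t) and resumming, which is legitimate
   because the stress is summable and the bar lengths are bounded, yields
   sum w_ij (p_i - p_j).(v_i - v_j) = 0, hence sum w_ij |v_i - v_j|^2 = 0 for
   small t > 0.  As t tends to 0 the fields v(t) tend uniformly to the initial
   velocity u, so u is an infinitesimal flex with sum w_ij |u_i - u_j|^2 = 0,
   and prestress stability forces u to be trivial. *)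
Require Import Defs.
From mathcomp Require Import all_boot all_order all_algebra.
From mathcomp Require Import all_classical all_reals all_analysis.
From mathcomp Require Import ring lra.
Set Implicit Arguments.
Unset Strict Implicit.
Unset Printing Implicit Defensive.
Import Order.TTheory GRing.Theory Num.Theory.
Import numFieldNormedType.Exports.
Local Open Scope classical_set_scope.
Local Open Scope ring_scope.

(** * Sums over pairs [i < j] as ordinary series *)

(** Pairs [i < j] are grouped by their larger index, so that sums over [lt_pairs] become series
    indexed by [nat], to which limit theorems apply. *)
Definition column_sum (V : nmodType) (f : nat -> nat -> V) (j : nat) : V :=
  \sum_(i < j) f i j.

Lemma esum_lt_pairs (R : realType) (g : nat -> nat -> R) :
  (forall i j, 0 <= g i j) ->
  (\esum_(e in lt_pairs) (g e.1 e.2)%:E = \sum_(j <oo) (column_sum g j)%:E)%E.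
Proof.
move=> g0.
rewrite (@reindex_esum _ _ _ (setT `*`` (fun j => `I_j)) lt_pairs
  (fun x => (x.2, x.1))); last first.
  split => [[j i] [_ /=] //|[j i] [j' i'] _ _ [-> ->] //|[i j] /= ij].
  by exists (j, i).
rewrite -(esum_esum (a := fun j i => (g i j)%:E))/=; last first.
  by move=> i j _ _; rewrite lee_fin.
rewrite nneseries_esumT; last by move=> j; rewrite lee_fin sumr_ge0.
apply: eq_esum => j _; rewrite esum_fset//; last by move=> i _; rewrite lee_fin.
by rewrite -fsbig_ord sumEFin.
Qed.

Lemma esum_lt_pairs_cvg (R : realType) (g : nat -> nat -> R) :
  (forall i j, 0 <= g i j) ->
  (\esum_(e in lt_pairs) (g e.1 e.2)%:E < +oo)%E ->
  exists2 L : R, (\esum_(e in lt_pairs) (g e.1 e.2)%:E = L%:E)%E &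
    series (column_sum g) @ \oo --> L.
Proof.
move=> g0 goo.
have goo' : \esum_(e in lt_pairs) (g e.1 e.2)%:E \is a fin_num.
  by rewrite ge0_fin_numE// esum_ge0// => e _; rewrite lee_fin.
exists (fine (\esum_(e in lt_pairs) (g e.1 e.2)%:E)); first by rewrite fineK.
move: goo'; rewrite esum_lt_pairs// => goo'.
have /fine_cvgP[_] : eseries (fun j => (column_sum g j)%:E) @ \oo -->
    (fine (\sum_(j <oo) (column_sum g j)%:E))%:E.
  rewrite fineK//; apply: is_cvg_nneseries => j _ _.
  by rewrite lee_fin sumr_ge0.
apply: cvg_trans; apply: near_eq_cvg; near=> n => /=.
by rewrite /eseries/= sumEFin.
Unshelve. all: by end_near.
Qed.

(** Positive and negative parts are both dominated by a multiple of the summable [|w|], so both sums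
    are finite and their difference is a genuine real limit. *)
Lemma sum_lt_cvg (R : realType) (w f : nat -> nat -> R) (C : R) :
  summable_stress w -> (forall i j, `|f i j| <= C * `|w i j|) ->
  exists2 L, sum_lt f = L%:E & series (column_sum f) @ \oo --> L.
Proof.
move=> sw fw.
pose M : R := Num.max C 0.
have fM i j : `|f i j| <= M * `|w i j|.
  by apply: le_trans (fw i j) _; rewrite ler_wpM2r// le_max lexx.
have dom (g : nat -> nat -> R) : (forall i j, 0 <= g i j) ->
    (forall i j, g i j <= `|f i j|) ->
    (\esum_(e in lt_pairs) (g e.1 e.2)%:E < +oo)%E.
  move=> g0 gf; rewrite esum_lt_pairs//.
  have [T sT cT] := esum_lt_pairs_cvg (g := fun i j => `|w i j|)
    (fun i j => normr_ge0 _) sw.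
  apply: (@le_lt_trans _ _ (\sum_(j <oo)
    (M%:E * (column_sum (fun i j => `|w i j|) j)%:E))%E).
    apply: lee_nneseries => [j _ _|j _]; first by rewrite lee_fin sumr_ge0.
    rewrite -EFinM lee_fin mulr_sumr; apply: ler_sum => i _.
    exact: le_trans (gf _ _) (fM _ _).
  rewrite nneseriesZl; last by move=> j _; rewrite lee_fin sumr_ge0.
  by rewrite -esum_lt_pairs// sT -EFinM ltry.
have [||P sP cP] := @esum_lt_pairs_cvg R (fun i j => Num.max (f i j) 0).
- by move=> i j; rewrite le_max lexx orbT.
- apply: (dom (fun i j => Num.max (f i j) 0)) => i j.
    by rewrite le_max lexx orbT.
  by rewrite ge_max ler_norm normr_ge0.
have [||N sN cN] := @esum_lt_pairs_cvg R (fun i j => Num.max (- f i j) 0).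
- by move=> i j; rewrite le_max lexx orbT.
- apply: (dom (fun i j => Num.max (- f i j) 0)) => i j.
    by rewrite le_max lexx orbT.
  by rewrite ge_max -normrN ler_norm normr_ge0.
exists (P - N); first by rewrite /sum_lt sP sN.
apply: cvg_trans (cvgB cP cN); apply: near_eq_cvg; near=> n => /=.
rewrite -[LHS]/(series _ n - series _ n) !seriesEord/= -sumrB; apply: eq_bigr => j _.
rewrite /column_sum -sumrB; apply: eq_bigr => i _.
have [f0|/ltW f0] := lerP 0 (f i j).
  by rewrite max_r ?subr0// oppr_le0.
by rewrite max_l ?sub0r ?opprK// oppr_ge0.
Unshelve. all: by end_near.
Qed.

(** A square splits into its two triangles and its zero diagonal; reflecting the lower triangle
    pairs [F j i] with [F i j]. *)
Lemma series_column_sum_sym (V : zmodType) (F : nat -> nat -> V) N :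
  (forall i, F i i = 0) ->
  series (column_sum (fun i j => F i j + F j i)) N =
  \sum_(i < N) \sum_(j < N) F i j.
Proof.
move=> F0; elim: N => [|N IH]; first by rewrite seriesEord/= !big_ord0.
rewrite seriesSr IH big_ord_recr/= big_ord_recr/= F0 addr0.
rewrite /column_sum big_split/= addrA; congr (_ + _).
by rewrite -big_split/=; apply: eq_bigr => i _; rewrite big_ord_recr.
Qed.

Lemma cvg_sum_ord (R : realType) (n : nat) (f : 'I_n -> nat -> R)
    (a : 'I_n -> R) : (forall i, f i @ \oo --> a i) ->
  (fun K => \sum_(i < n) f i K) @ \oo --> \sum_(i < n) a i.
Proof.
move=> fa; apply: (@cvg_big R 'I_n +%R 0 xpredT _ _ _ _ f a) => [|i _].
  exact: (@add_continuous R).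
exact: fa.
Qed.

(* An absolutely convergent double series with vanishing rows sums to zero
   also along the squares [i, j < N]: the part of the first N rows outside the
   N-th square is bounded by a tail of the dominating series. *)
Lemma cvg_square_sums0 (R : realType) (F h : nat -> nat -> R) (T : R) :
  (forall i j, `|F i j| <= h i j) ->
  series (column_sum h) @ \oo --> T ->
  (forall i, series (F i) @ \oo --> (0 : R)) ->
  (fun N => \sum_(i < N) \sum_(j < N) F i j) @ \oo --> (0 : R).
Proof.
move=> Fh hT F0.
have h0 i j : 0 <= h i j by exact: le_trans (normr_ge0 _) (Fh i j).
have bnd N : `|\sum_(i < N) \sum_(j < N) F i j| <=
    T - series (column_sum h) N.
  have c1 : (fun K => \sum_(i < N) series (F i) K) @ \oo --> (0 : R).
    have := @cvg_sum_ord R N (fun i => series (F i)) (fun=> 0) (fun i => F0 i).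
    by rewrite big1.
  have c2 := cvg_norm (cvgB (cvg_cst (\sum_(i < N) \sum_(j < N) F i j)) c1).
  rewrite subr0 in c2.
  have c3 := cvgB hT (cvg_cst (series (column_sum h) N)).
  apply: (ler_cvg_to (c2 _ _ _) (c3 _ _)).
  near=> K.
  have NK : (N <= K)%N by near: K; exact: nbhs_infty_ge.
  rewrite -[leRHS]/(series (column_sum h) K - series (column_sum h) N).
  rewrite -[X in `|X|]/(_ - \sum_(i < N) series (F i) K).
  rewrite sub_series_geq// -sumrB.
  under eq_bigr => i _.
    rewrite -opprB.
    rewrite (_ : \sum_(j < N) F i j = series (F i) N); last first.
      by rewrite seriesEord.
    rewrite sub_series_geq//; over.
  rewrite sumrN normrN exchange_big/=.
  apply: le_trans (ler_norm_sum _ _ _) _.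
  rewrite !big_nat; apply: ler_sum => j /andP[Nj _].
  apply: le_trans (ler_norm_sum _ _ _) _.
  (* Since [N <= j], column [j] contains all rows [i < N]; its other terms are nonnegative. *)
  rewrite /column_sum -(subnKC Nj) big_split_ord/= subnKC//.
  rewrite ler_wpDr ?sumr_ge0//; apply: ler_sum => i _; exact: Fh.
apply/cvgr0Pnorm_le => e e0; near=> N.
apply: le_trans (bnd N) _; apply: le_trans (ler_norm _) _.
near: N; move/cvgrPdist_le : hT; exact.
Unshelve. all: by end_near.
Qed.


(** * Euclidean inner product *)

Section dot.
Variables (R : realType) (d : nat).
Implicit Types x y z : 'cV[R]_d.

Lemma dotC x y : dot x y = dot y x.
Proof. by apply: eq_bigr => k _; rewrite mulrC. Qed.

Lemma dotDl x y z : dot (x + y) z = dot x z + dot y z.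
Proof. by rewrite -big_split/=; apply: eq_bigr => k _; rewrite mxE mulrDl. Qed.

Lemma dotZl a x y : dot (a *: x) y = a * dot x y.
Proof. by rewrite mulr_sumr; apply: eq_bigr => k _; rewrite mxE mulrA. Qed.

Lemma dotNl x y : dot (- x) y = - dot x y.
Proof. by rewrite -scaleN1r dotZl mulN1r. Qed.

Lemma dot0l y : dot 0 y = 0.
Proof. by rewrite -(scale0r 0) dotZl mul0r. Qed.

Lemma dotBl x y z : dot (x - y) z = dot x z - dot y z.
Proof. by rewrite dotDl dotNl. Qed.

Lemma dotDr x y z : dot x (y + z) = dot x y + dot x z.
Proof. by rewrite dotC dotDl !(dotC _ x). Qed.

Lemma dotBr x y z : dot x (y - z) = dot x y - dot x z.
Proof. by rewrite dotC dotBl !(dotC _ x). Qed.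

Lemma dotZr a x y : dot x (a *: y) = a * dot x y.
Proof. by rewrite dotC dotZl dotC. Qed.

Lemma dot_subr_sqr x y : dot x x - dot y y = dot (x - y) (x + y).
Proof. by rewrite dotBl !dotDr (dotC y x); ring. Qed.

Lemma dot_suml (I : Type) (r : seq I) (P : pred I) (F : I -> 'cV[R]_d) y :
  dot (\sum_(i <- r | P i) F i) y = \sum_(i <- r | P i) dot (F i) y.
Proof.
exact: (big_morph (fun x => dot x y) (fun a b => dotDl a b y) (dot0l y)).
Qed.

Lemma dot_ge0 x : 0 <= dot x x.
Proof. by apply: sumr_ge0 => k _; rewrite -expr2 sqr_ge0. Qed.

Lemma enorm_sqr x : enorm x ^+ 2 = dot x x.
Proof. by rewrite sqr_sqrtr// dot_ge0. Qed.

Lemma ler_coord_enorm x k : `|x k 0| <= enorm x.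
Proof.
rewrite -sqrtr_sqr ler_sqrt ?dot_ge0// /dot (bigD1 k)//= -expr2 lerDl.
by apply: sumr_ge0 => l _; rewrite -expr2 sqr_ge0.
Qed.

(* Cruder than Cauchy-Schwarz, but only fixed multiples of the bounds matter. *)
Lemma ler_norm_dot x y a b : (forall k, `|x k 0| <= a) ->
  (forall k, `|y k 0| <= b) -> `|dot x y| <= d%:R * (a * b).
Proof.
move=> xa yb; apply: le_trans (ler_norm_sum _ _ _) _.
rewrite mulr_natl -[in X in _ <= X](card_ord d) -sumr_const.
by apply: ler_sum => k _; rewrite normrM ler_pM.
Qed.

Lemma cvg_dotl (u : nat -> 'cV[R]_d) x y :
  u @ \oo --> x -> (fun n => dot (u n) y) @ \oo --> dot x y.
Proof.
move=> ux.
apply: (@cvg_sum_ord R d (fun k n => u n k 0 * y k 0) (fun k => x k 0 * y k 0)).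
move=> k.
apply: cvgMr_tmp; apply: (cvg_comp u (fun M : 'cV[R]_d => M k 0)) ux _.
exact: coord_continuous.
Qed.

End dot.

(** * Coordinatewise bounds from suprema *)

Lemma le_linf_norm (R : realType) (d : nat) (u : nat -> 'cV[R]_d) (a : R) k l :
  (linf_norm u <= a%:E)%E -> `|u k l 0| <= a.
Proof.
move=> ua; rewrite (le_trans (ler_coord_enorm _ _))// -lee_fin.
by apply: le_trans ua; apply: ereal_sup_ubound; exists k.
Qed.

Lemma bounded_field_coord (R : realType) (d : nat) (u : nat -> 'cV[R]_d) :
  bounded_field u -> exists2 U : R, 0 <= U & forall k l, `|u k l 0| <= U.
Proof.
move=> bu.
have u0 : (0 <= linf_norm u)%E.
  apply: (@le_trans _ _ (enorm (u 0%N))%:E).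
    by rewrite lee_fin sqrtr_ge0.
  by apply: ereal_sup_ubound; exists 0%N.
exists (fine (linf_norm u)) => [|k l]; first exact: fine_ge0.
by apply: le_linf_norm; rewrite fineK// ge0_fin_numE.
Qed.

Lemma bounded_bars_coord (R : realType) (d : nat) (G : sgraph)
    (p : nat -> 'cV[R]_d) : bounded_bars G p ->
  exists M : R, forall i j l, adj G i j -> `|(p i - p j) l 0| <= M.
Proof.
rewrite /bounded_bars; set s := ereal_sup _ => soo.
(* Without edges [s] is -oo and [fine s] is a default value; a given edge rules this out. *)
exists (fine s) => i j l ij; rewrite (le_trans (ler_coord_enorm _ _))//.
have es : ((enorm (p i - p j))%:E <= s)%E.
  by apply: ereal_sup_ubound; exists (i, j).
rewrite -lee_fin fineK// fin_numElt soo andbT.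
by rewrite (lt_le_trans _ es)// ltNyr.
Qed.

(** * Virtual work of an equilibrium stress *)

Lemma equilibrium_stress_work0 (R : realType) (d : nat) (G : sgraph)
    (p v : nat -> 'cV[R]_d) (w : nat -> nat -> R) (B : R) :
  bounded_bars G p -> equilibrium_stress G p w -> summable_stress w ->
  (forall k l, `|v k l 0| <= B) ->
  series (column_sum (fun i j => w i j * dot (p i - p j) (v i - v j)))
    @ \oo --> (0 : R).
Proof.
move=> /bounded_bars_coord[M pM] [[wsym wadj] weq] sw vB.
(* The work of a bar is [F i j + F j i] by symmetry of [w], and each row of [F] sums to zero by
   equilibrium at [i]. *)
pose F i j := w i j * dot (p i - p j) (v i).
pose C := d%:R * (M * B).
have FC i j : `|F i j| <= `|C| * `|w i j|.
  (* Lengths are bounded on edges only; elsewhere the stress vanishes. *)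
  case: (boolP (adj G i j)) => [ij|/wadj wij]; last first.
    by rewrite /F wij mul0r normr0 mulr0.
  rewrite normrM mulrC ler_wpM2r//; apply: le_trans (ler_norm C).
  by apply: ler_norm_dot => l; [exact: pM|exact: vB].
have [|T _ hT] := @sum_lt_cvg R w (fun i j => `|C| * `|w i j|) `|C| sw.
  by move=> i j; rewrite normrM !normr_id.
have rows i : series (F i) @ \oo --> (0 : R).
  have := @cvg_dotl R d _ _ (v i) (weq i); rewrite dot0l.
  apply: cvg_trans; apply: near_eq_cvg; near=> n.
  rewrite /series/= dot_suml; apply: eq_bigr => j _.
  by rewrite dotZl.
have := cvg_square_sums0 FC hT rows.
apply: cvg_trans; apply: near_eq_cvg; near=> n.
rewrite -series_column_sum_sym; last by move=> i; rewrite /F subrr dot0l mulr0.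
rewrite !seriesEord; apply: eq_bigr => j _; apply: eq_bigr => i _.
by rewrite /F dotBr (wsym j i) -(opprB (p i)) dotNl mulrN mulrBr.
Unshelve. all: by end_near.
Qed.

(** * From finite displacements to the initial velocity *)

Lemma dot_first_order (R : realType) (d : nat) (x y : 'cV[R]_d) (t : R) :
  t != 0 -> enorm (x + t *: y) = enorm x -> dot x y = - (t / 2) * dot y y.
Proof.
move=> t0 /(congr1 (fun a => a ^+ 2)); rewrite !enorm_sqr.
rewrite dotDl !dotDr !dotZl !dotZr (dotC y x) => e.
apply: (mulfI t0); lra.
Qed.

(** If [x] is nonzero, [e = 1] forces [K > 0], and then [e = |x| / (2 K)] gives [|x| <= |x| / 2].
    This replaces explicit limits in [t] by one approximation per [e]. *)
Lemma norm_le_eps_eq0 (R : realFieldType) (x K : R) :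
  (forall e, 0 < e -> e <= 1 -> `|x| <= e * K) -> x = 0.
Proof.
move=> H; apply: contrapT => /eqP x0.
have nx : 0 < `|x| by rewrite normr_gt0.
have K0 : 0 < K by apply: (lt_le_trans nx); rewrite -(mul1r K) H.
have : `|x| <= `|x| / (2 * K) * K.
  apply: (H); first by rewrite divr_gt0// mulr_gt0.
  rewrite ler_pdivrMr ?mulr_gt0// mul1r.
  have := H 1 ltr01 (lexx _); lra.
rewrite invfM !mulrA mulfVK ?gt_eqF//; lra.
Qed.

Lemma ler_norm_coordB (R : realType) (d : nat) (x y : 'cV[R]_d) (a : R) l :
  `|x l 0| <= a -> `|y l 0| <= a -> `|(x - y) l 0| <= 2 * a.
Proof.
move=> xa ya; rewrite !mxE mulr2n mulrDl !mul1r.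
by rewrite (le_trans (ler_normB _ _))// lerD.
Qed.

Theorem theorem3p17 (R : realType) (d : nat) (G : sgraph)
    (p : nat -> 'cV[R]_d) (bars : bounded_bars G p)
    (stable : boundedly_prestress_stable G p) :
  directedly_continuously_rigid G p.
Proof.
move=> [q [[[_ q0 bar] _] [u [[bu cu] ntu]]]].
have [w [weq sw wpos]] := stable.
have [U U0 uU] := bounded_field_coord bu.
have [M pM] := bounded_bars_coord bars.
(* One time [t <= e] is chosen per tolerance [e]; [v] is the difference quotient of the motion at
   [t], uniformly within [e] of [u]. *)
have approx e : 0 < e -> e <= 1 -> exists t v, [/\ 0 < t, t <= e,
    forall i j, adj G i j ->
      dot (p i - p j) (v i - v j) = - (t / 2) * dot (v i - v j) (v i - v j),
    forall k l, `|v k l 0| <= U + 1 & forall k l, `|(u k - v k) l 0| <= e].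
  move=> e0 e1.
  have cue : \forall t \near 0^'+,
      (linf_norm (fun k => t^-1 *: (q t k - q 0 k) - u k)%R <= e%:E)%E.
    have /cu e_near : nbhs (0 : \bar R) [set y | (y < e%:E)%E].
      exact: (@nbhs_open_ereal_lt R 0 (fun=> e)).
    by near=> t; apply: ltW; near: t; exact: e_near.
  have [t [t0 te tu]] : exists t : R, [/\ 0 < t, t <= e &
      (linf_norm (fun k => t^-1 *: (q t k - q 0 k) - u k)%R <= e%:E)%E].
    near (0 : R)^'+ => t; exists t; split; last by near: t.
      by near: t; exact: nbhs_right_gt.
    by near: t; exact: nbhs_right_le.
  pose v k := t^-1 *: (q t k - q 0 k).
  have uv k l : `|(u k - v k) l 0| <= e.
    rewrite -opprB mxE normrN; exact: (le_linf_norm _ _ tu).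
  exists t, v; split => // [i j ij|k l].
    apply: dot_first_order; first by rewrite gt_eqF.
    rewrite -(bar t _ i j ij) ?(ltW t0) ?(le_trans te)//; congr enorm.
    rewrite -scalerBr scalerA divff ?gt_eqF// scale1r q0.
    by apply/matrixP => a b; rewrite !mxE; lra.
  rewrite (_ : v k l 0 = u k l 0 - (u k - v k) l 0); last by rewrite !mxE; lra.
  by rewrite (le_trans (ler_normB _ _))// lerD// (le_trans (uv _ _)).
have V0 : 0 <= U + 1 by lra.
have flex : inf_flex G p u.
  move=> i j ij.
  (* The first term bounds the error of replacing [u] by [v], the second the quadratic term with
     factor [t / 2 <= e]. *)
  apply: (@norm_le_eps_eq0 _ _ (d%:R * (M * 2) +
    d%:R * ((2 * (U + 1)) * (2 * (U + 1))))) => e e0 e1.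
  have [t [v [t0 te vp vU uv]]] := approx e e0 e1.
  rewrite (_ : u i - u j = (u i - v i) - (u j - v j) + (v i - v j)); last first.
    by apply/matrixP => a b; rewrite !mxE; lra.
  rewrite dotDr (le_trans (ler_normD _ _))// mulrDr lerD//.
    rewrite (_ : e * _ = d%:R * (M * (2 * e))); last by ring.
    apply: ler_norm_dot => l; first exact: pM.
    exact: ler_norm_coordB.
  rewrite vp// normrM ler_pM//.
    by rewrite normrN ger0_norm; lra.
  by apply: ler_norm_dot => l; exact: ler_norm_coordB.
have := wpos u flex bu ntu.
have [|L -> cL] := @sum_lt_cvg R w (fun i j => w i j * enorm (u i - u j) ^+ 2)
  (d%:R * ((2 * U) * (2 * U))) sw.
  move=> i j; rewrite enorm_sqr normrM mulrC ler_wpM2r//.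
  by apply: ler_norm_dot => l; exact: ler_norm_coordB.
have [|T _ cT] := @sum_lt_cvg R w (fun i j => `|w i j|) 1 sw.
  by move=> i j; rewrite normr_id mul1r.
suff -> : L = 0 by rewrite ltxx.
apply: (@norm_le_eps_eq0 _ _ (d%:R * (2 * (4 * (U + 1))) * T)) => e e0 e1.
have [t [v [t0 te vp vU uv]]] := approx e e0 e1.
pose g i j := w i j * dot (v i - v j) (v i - v j).
have cg : series (column_sum g) @ \oo --> (0 : R).
  have := equilibrium_stress_work0 bars weq sw vU.
  (* On each bar the factor [- (2 / t)] turns the work into [g i j]; off the bars both vanish. *)
  move=> /(cvgMl_tmp (a := - (2 / t))) /(_ _); rewrite mulr0.
  apply: cvg_trans; apply: near_eq_cvg; near=> n => /=.
  rewrite !seriesEord/= mulr_sumr; apply: eq_bigr => j _.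
  rewrite /column_sum mulr_sumr; apply: eq_bigr => i _; rewrite /g.
  case: (boolP (adj G i j)) => [ij|/(proj2 weq.1) ->]; last first.
    by rewrite !mul0r mulr0.
  by rewrite vp//; field; rewrite gt_eqF.
have c1 := cvg_norm (cvgB cL cg); rewrite subr0 in c1.
have c2 := cvgMl_tmp (a := e * (d%:R * (2 * (4 * (U + 1))))) cT.
rewrite (mulrA e).
(* The partial sums for [u] and [v] are compared termwise against [|w|], and the bound passes to the
   limit. *)
apply: (ler_cvg_to (c1 _ _) (c2 _)).
near=> n.
rewrite -[X in `|X|]/(series _ n - series _ n) !seriesEord/= -sumrB mulr_sumr.
apply: le_trans (ler_norm_sum _ _ _) _; apply: ler_sum => j _.
rewrite /column_sum -sumrB mulr_sumr.
apply: le_trans (ler_norm_sum _ _ _) _; apply: ler_sum => i _.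
rewrite enorm_sqr -mulrBr normrM mulrC ler_wpM2r//.
set a := u i - u j; set b := v i - v j.
(* As [|a|^2 - |b|^2 = (a - b).(a + b)], the difference is linear in [e]: coordinates of [a - b] are
   at most [2 * e], those of [a + b] at most [4 * (U + 1)]. *)
rewrite dot_subr_sqr.
rewrite (_ : e * _ = d%:R * (2 * e * (4 * (U + 1)))); last by ring.
apply: ler_norm_dot => l.
  rewrite (_ : a - b = (u i - v i) - (u j - v j)).
    exact: ler_norm_coordB.
  by apply/matrixP => x y; rewrite !mxE; lra.
rewrite mxE (le_trans (ler_normD _ _))//.
rewrite (_ : 4 * _ = 2 * (U + 1) + 2 * (U + 1)); last by ring.
by rewrite lerD// ler_norm_coordB// (le_trans (uU _ _))//; lra.
Unshelve. all: by end_near.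
Qed.
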